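(* Let $P$ be a finite poset, let $w$ be the width of $P$, and let $\mathcal{C}_{-1}$ be the family of maximal $*$-antichains of $P$. Then $\left|\bigcup \mathcal{C}_{-1}\right| \leq \frac{w(w+1)}{2}$. This bound is best possible: for every integer $w \geq 1$ there is a poset of width $w$ for which equality holds.
   Context: The width of $P$ is the maximum cardinality of an antichain of $P$. For an antichain $A$ of $P$ let $[A) = \{x \in P \mid x \geq y \text{ for some } y \in A\}$. The set of all antichains of $P$ is ordered by the filter order: $A \leq B$ iff $[A) \supseteq [B)$. An antichain $A$ of $P$ is a maximal $r$-antichain iff $|A| = r$ and $A$ is maximal (in the filter order) among the $r$-element antichains of $P$. A maximal $*$-antichain is an antichain that is a maximal $r$-antichain for some $r$. *)

(* Defs.v *)
From HB Require Import structures.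
From mathcomp Require Import all_boot all_order.

Set Implicit Arguments.
Unset Strict Implicit.
Unset Printing Implicit Defensive.

Import Order.TTheory.

Section Antichains.
Context {d : Order.disp_t} {P : finPOrderType d}.
Implicit Types A B : {set P}.

Definition antichain A : bool :=
  [forall x in A, forall y in A, (x <= y)%O ==> (x == y)].

Definition filter_of A : {set P} := [set x | [exists y in A, (y <= x)%O]].

(* The inclusion is reversed: larger antichains generate smaller filters. *)
Definition filter_le A B : bool := filter_of B \subset filter_of A.

(* Maximal, not greatest: for a given r there may be several such A. *)
Definition maximal_antichain (r : nat) A : bool :=
  [&& antichain A, #|A| == r &
    [forall B : {set P},
      [&& antichain B, #|B| == r & filter_le A B] ==> (B == A)]].

(* The size r is at most #|P|, so it may be taken in a finite type; see
   [maximal_star_antichainP]. *)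
Definition maximal_star_antichain A : bool :=
  [exists r : 'I_#|P|.+1, maximal_antichain r A].

Lemma maximal_star_antichainP A :
  reflect (exists r : nat, maximal_antichain r A) (maximal_star_antichain A).
Proof.
apply: (iffP existsP) => [[r Ar]|[r Ar]]; first by exists r.
have ltr : r < #|P|.+1 by case/and3P: Ar => _ /eqP <- _; apply: max_card.
by exists (Ordinal ltr).
Qed.

End Antichains.

Definition width {d : Order.disp_t} (P : finPOrderType d) : nat :=
  \max_(A : {set P} | antichain A) #|A|.

Definition maximal_star_antichains {d : Order.disp_t} (P : finPOrderType d) :
    {set {set P}} :=
  [set A : {set P} | maximal_star_antichain A].

(* Main.v *)
(* Write f(F) for the number of minimal elements of a filter F, and call F
   strict if f(G) < f(F) for all filters G properly contained in F; a maximal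
   *-antichain generates a strict filter. Since f is supermodular, the union of
   two strict filters is strict. Let T_r be the set of the x such that r is the
   largest f(F) over the strict filters F having x as a minimal element. If
   x in T_r is minimal in the strict filter F with f(F) = r, and G is another
   strict filter with f(G) = r, then x is in G: otherwise x would be minimal in
   the union of F and G, for which f exceeds r. Hence T_r is an antichain
   contained in a strict filter with r minimal elements, so |T_r| <= r, and
   summing over r <= w gives the bound. *)
Require Import Defs.
From HB Require Import structures.
From mathcomp Require Import all_boot all_order.

Set Implicit Arguments.
Unset Strict Implicit.
Unset Printing Implicit Defensive.

Import Order.TTheory.

Lemma triangular_sum n : \sum_(r < n.+1) r = (n * (n + 1)) %/ 2.
Proof. by rewrite -(big_mkord xpredT id) bin2_sum bin2 divn2 addn1 mulnC. Qed.

(** * Filters and their minimal elements *)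

Section Filters.
Context {d : Order.disp_t} {P : finPOrderType d}.
Implicit Types (A B F G : {set P}) (x y : P).

Definition minimals F : {set P} :=
  [set x in F | [forall y in F, (y <= x)%O ==> (y == x)]].

Definition upper_set F : bool :=
  [forall x in F, forall y, (x <= y)%O ==> (y \in F)].

Definition strict_filter F : bool :=
  upper_set F &&
  [forall G : {set P},
    upper_set G && (G \proper F) ==> (#|minimals G| < #|minimals F|)].

Definition strict_minimal x F : bool := strict_filter F && (x \in minimals F).

(** The index [r] with [x] in T_r; it is 0 by default when [x] is minimal in no strict filter. *)
Definition strict_rank x : nat :=
  \max_(F : {set P} | strict_minimal x F) #|minimals F|.

Lemma upper_setP F :
  reflect (forall x y, x \in F -> (x <= y)%O -> y \in F) (upper_set F).
Proof.
apply: (iffP forall_inP) => [uF x y xF|uF x xF].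
  by move/forallP/(_ y)/implyP: (uF x xF).
by apply/forallP => y; apply/implyP; apply: uF.
Qed.

Lemma strict_filterP F :
  reflect (upper_set F /\ forall G, upper_set G -> G \proper F ->
             #|minimals G| < #|minimals F|)
    (strict_filter F).
Proof.
apply: (iffP andP) => -[uF sF]; split=> //; first move=> G uG pG.
  by move/forallP/(_ G)/implyP: sF; apply; rewrite uG.
by apply/forallP => G; apply/implyP => /andP[]; apply: sF.
Qed.

Lemma antichainP A :
  reflect {in A &, forall x y, (x <= y)%O -> x = y} (antichain A).
Proof.
apply: (iffP forall_inP) => [acA x y xA yA le_xy|acA x xA].
  by apply/eqP; move/forall_inP/(_ y yA)/implyP: (acA x xA); apply.
by apply/forall_inP => y yA; apply/implyP => le_xy; apply/eqP/acA.
Qed.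

Lemma minimalsP F x :
  reflect (x \in F /\ {in F, forall y, (y <= x)%O -> y = x})
    (x \in minimals F).
Proof.
rewrite inE; apply: (iffP andP) => -[xF]; last first.
  move=> minx; split=> //; apply/forall_inP => y yF; apply/implyP => le_yx.
  exact/eqP/minx.
by move/forall_inP=> minx; split=> // y /minx/implyP h /h/eqP.
Qed.

Lemma minimals_antichain F : antichain (minimals F).
Proof.
apply/antichainP => x y /minimalsP[xF _] /minimalsP[_ miny] le_xy.
exact: miny.
Qed.

Lemma upper_setU F G : upper_set F -> upper_set G -> upper_set (F :|: G).
Proof.
move=> /upper_setP uF /upper_setP uG; apply/upper_setP => x y.
by case/setUP=> [/uF|/uG] h /h yFG; rewrite inE yFG ?orbT.
Qed.

Lemma upper_setI F G : upper_set F -> upper_set G -> upper_set (F :&: G).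
Proof.
move=> /upper_setP uF /upper_setP uG; apply/upper_setP => x y /setIP[xF xG].
by move=> le_xy; rewrite inE (uF x y) ?(uG x y).
Qed.

Lemma filter_ofP A x :
  reflect (exists2 y, y \in A & (y <= x)%O) (x \in filter_of A).
Proof. by rewrite inE; apply: (iffP exists_inP). Qed.

Lemma sub_filter_of A : A \subset filter_of A.
Proof. by apply/subsetP => x xA; apply/filter_ofP; exists x. Qed.

Lemma upper_filter_of A : upper_set (filter_of A).
Proof.
apply/upper_setP => x y /filter_ofP[z zA le_zx] le_xy.
apply/filter_ofP; exists z => //; exact: le_trans le_xy.
Qed.

Lemma filter_of_min A F : upper_set F -> A \subset F -> filter_of A \subset F.
Proof.
move=> /upper_setP uF /subsetP sAF; apply/subsetP => x /filter_ofP[y /sAF yF].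
exact: uF.
Qed.

Lemma minimals_filter_of A : antichain A -> minimals (filter_of A) = A.
Proof.
move/antichainP=> acA; apply/setP=> x; apply/minimalsP/idP => [[]|xA].
  case/filter_ofP=> y yA le_yx /(_ y) <- //.
  exact: (subsetP (sub_filter_of A)).
split=> [|y /filter_ofP[z zA le_zy] le_yx].
  exact: (subsetP (sub_filter_of A)).
apply: le_anti; rewrite le_yx /=.
by rewrite -(acA z x zA xA (le_trans le_zy le_yx)).
Qed.

(** * Supermodularity and strict filters *)

(** A minimal element of [F] stays minimal in the intersection if it lies in [G], and in the union
    otherwise, since nothing in the upper set [G] is below it. An element minimal in both [F] and
    [G] is minimal in both union and intersection. *)
Lemma minimals_supermodular F G : upper_set F -> upper_set G ->
  #|minimals F| + #|minimals G|
    <= #|minimals (F :|: G)| + #|minimals (F :&: G)|.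
Proof.
move=> uF uG; rewrite -cardsUI -[leqRHS]cardsUI.
have minU H K x : upper_set K -> x \in minimals H -> x \notin K ->
    x \in minimals (H :|: K).
  move=> /upper_setP uK /minimalsP[xH minx] xK; apply/minimalsP; split.
    by rewrite inE xH.
  by move=> y /setUP[/minx//|yK] le_yx; rewrite (uK _ _ yK le_yx) in xK.
have minI (H K : {set P}) x :
    x \in minimals H -> x \in K -> x \in minimals (H :&: K).
  move=> /minimalsP[xH minx] xK; apply/minimalsP; rewrite inE xH xK.
  by split=> // y /setIP[/minx].
apply: leq_add; apply: subset_leq_card; apply/subsetP => x; last first.
  case/setIP=> xF /minimalsP[xG minx]; rewrite inE minI // andbT.
  move/minimalsP: xF => [xF minx']; apply/minimalsP.
  by rewrite inE xF; split=> // y /setUP[/minx'|/minx].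
case/setUP=> [xF|xG]; apply/setUP.
  have [xG|xG] := boolP (x \in G); first by right; apply: minI.
  by left; apply: minU.
rewrite setUC (setIC F).
have [xF|xF] := boolP (x \in F); first by right; apply: minI.
by left; apply: minU.
Qed.

(** If [F] is not inside [G], then [G :&: F] is proper in [F] and has fewer minimal elements;
    supermodularity turns this loss into a gain for the union. *)
Lemma strict_filter_setU_ge F G : strict_filter F -> upper_set G ->
  #|minimals G| <= #|minimals (G :|: F)| ?= iff (F \subset G).
Proof.
move=> /strict_filterP[uF sF] uG.
have [/setUidPl->|nsFG] := boolP (F \subset G); first exact/leqif_refl.
suff lt_GU : #|minimals G| < #|minimals (G :|: F)|.
  by split; [exact: ltnW | rewrite ltn_eqF].
have /sF : G :&: F \proper F.
  by rewrite properE subsetIr subsetI subxx andbT nsFG.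
move=> /(_ (upper_setI uG uF)) ltI.
rewrite -(ltn_add2r #|minimals F|).
by rewrite (leq_ltn_trans (minimals_supermodular uG uF)) // ltn_add2l.
Qed.

Lemma strict_filterU F G :
  strict_filter F -> strict_filter G -> strict_filter (F :|: G).
Proof.
move=> sF sG; have [uF _] := strict_filterP _ sF.
have [uG _] := strict_filterP _ sG.
apply/strict_filterP; split=> [|H uH /andP[sHFG nsFGH]].
  exact: upper_setU.
(* Adding [F] and then [G] to [H] yields [F :|: G]. Equality at both stages would put [F] and [G]
   inside [H]. *)
have /= le1 := strict_filter_setU_ge sF uH.
have /= le2 := strict_filter_setU_ge sG (upper_setU uH uF).
have := leqif_trans le1 le2; rewrite -setUA (setUidPr sHFG) => -[le3 eq3].
rewrite ltn_neqAle le3 eq3 andbT; apply: contra nsFGH => /andP[sFH].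
by rewrite (setUidPl sFH) subUset sFH.
Qed.

(** A properly smaller filter with at least [r] minimal elements would contain an [r]-antichain [B]
    above [A]. Maximality gives [B = A], so that filter would contain all of [filter_of A]. *)
Lemma maximal_antichain_strict r A :
  maximal_antichain r A -> strict_filter (filter_of A).
Proof.
case/and3P=> acA /eqP cardA /forallP maxA.
apply/strict_filterP.
split=> [|G uG /andP[sGA nsAG]]; first exact: upper_filter_of.
rewrite minimals_filter_of // ltnNge; apply/negP => leAG.
have /set0Pn[B] : [set B : {set P} | B \subset minimals G & #|B| == r] != set0.
  by rewrite -card_gt0 cards_draws bin_gt0 -cardA.
rewrite inE => /andP[sBG cardB].
have sBG' : B \subset G by apply/(subset_trans sBG)/subsetP => x /minimalsP[].
have acB : antichain B.
  have /antichainP acG := minimals_antichain G.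
  apply/antichainP => x y xB yB; apply: acG; exact: (subsetP sBG).
have /eqP eqBA : B == A.
  apply: (implyP (maxA B)); rewrite acB cardB /=.
  exact: subset_trans (filter_of_min uG sBG') sGA.
by move: nsAG; rewrite filter_of_min // -eqBA.
Qed.

(** * Rank classes and the upper bound *)

Lemma strict_rankP x F : strict_minimal x F ->
  exists2 G, strict_minimal x G & strict_rank x = #|minimals G|.
Proof.
move=> xF; have [|G xG rG] := @eq_bigmax_cond _ [pred G | strict_minimal x G]
  (fun G : {set P} => #|minimals G|); last first.
  by exists G => //; rewrite -rG; apply: eq_bigl.
by apply/card_gt0P; exists F.
Qed.

Lemma strict_rank_ge x F : strict_minimal x F -> #|minimals F| <= strict_rank x.
Proof. by move=> xF; apply: (bigop.bigmax_sup F). Qed.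

Lemma strict_rank_mem x F G :
  strict_minimal x F -> strict_rank x = #|minimals F| ->
  strict_filter G -> #|minimals G| = #|minimals F| -> x \in G.
Proof.
move=> /andP[sF xF] rx sG eqGF; apply: contraT => xG.
have [uF _] := strict_filterP _ sF; have [uG _] := strict_filterP _ sG.
have sFG := strict_filterU sF sG.
have xFG : strict_minimal x (F :|: G).
  rewrite /strict_minimal sFG; case/minimalsP: xF => xF minx.
  apply/minimalsP; rewrite inE xF; split=> // y /setUP[/minx//|yG] le_yx.
  by rewrite ((upper_setP _ uG) _ _ yG le_yx) in xG.
(* Strictness of the union now gives it more minimal elements than [G], hence more than the rank of
   [x]. *)
have pG : G \proper F :|: G.
  case/minimalsP: xF => xF _; rewrite properE subsetUr; apply: contra xG.
  by move/subsetP; apply; rewrite inE xF.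
have [_ /(_ _ uG pG)] := strict_filterP _ sFG.
by rewrite eqGF -rx ltnNge strict_rank_ge.
Qed.

(** The set T_r. The existence condition excludes elements whose rank is 0 only by default, so that
    T_0 is empty. *)
Definition strict_class r : {set P} :=
  [set x | [exists F, strict_minimal x F] & strict_rank x == r].

Lemma card_strict_class r : #|strict_class r| <= r.
Proof.
have [->|[x0]] := set_0Vmem (strict_class r); first by rewrite cards0.
have classP x : x \in strict_class r ->
    exists F, [/\ strict_minimal x F, strict_rank x = #|minimals F|
                & #|minimals F| = r].
  rewrite inE => /andP[/existsP[F /strict_rankP[G xG rx]] /eqP <-].
  by exists G.
case/classP=> F0 [/andP[sF0 _] _ cF0].
have [uF0 mF0] := strict_filterP _ sF0.
have acT : antichain (strict_class r).
  apply/antichainP => x y /classP[F [xF rx cF]] /classP[G [/andP[sG yG] _ cG]].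
  case/minimalsP: yG => _; apply.
  by apply: strict_rank_mem xF rx sG _; rewrite cG.
rewrite -(minimals_filter_of acT).
have sTF0 : filter_of (strict_class r) \subset F0.
  apply: filter_of_min => //; apply/subsetP => x /classP[F [xF rx cF]].
  by apply: strict_rank_mem xF rx sF0 _; rewrite cF.
rewrite -[leqRHS]cF0.
(* The filter generated by T_r is [F0] or properly inside it; in the second case strictness of [F0]
   applies. *)
have [->//|neF0] := eqVneq (filter_of (strict_class r)) F0.
by apply/ltnW/mF0; [exact: upper_filter_of | rewrite properEneq neF0].
Qed.

Lemma antichain_width A : antichain A -> #|A| <= width P.
Proof. by move=> acA; apply: (bigop.bigmax_sup A). Qed.

Lemma card_cover_maximal_star :
  #|cover (maximal_star_antichains P)| <= (width P * (width P + 1)) %/ 2.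
Proof.
rewrite -triangular_sum.
pose V := \bigcup_(r < (width P).+1) strict_class r.
have sUV : cover (maximal_star_antichains P) \subset V.
  apply/subsetP => x /bigcupP[A]; rewrite inE.
  case/maximal_star_antichainP=> r maxA xA.
  have /and3P[acA _ _] := maxA.
  have xF : strict_minimal x (filter_of A).
    by rewrite /strict_minimal (maximal_antichain_strict maxA)
      minimals_filter_of.
  have ltr : strict_rank x < (width P).+1.
    have [G _ ->] := strict_rankP xF.
    by rewrite ltnS antichain_width // minimals_antichain.
  apply/bigcupP; exists (Ordinal ltr) => //.
  by rewrite inE eqxx andbT; apply/existsP; exists (filter_of A).
apply: leq_trans (subset_leq_card sUV) _.
rewrite /V; elim/big_rec2: _ => [|i n A _ le_An]; first by rewrite cards0.
apply: leq_trans (leq_card_setU _ _) (leq_add _ le_An).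
exact: card_strict_class.
Qed.

End Filters.

(* Ordinal sum of antichains of sizes 1, ..., w, the smallest on top. *)
Definition layers (w : nat) : Type := {k : 'I_w & 'I_k.+1}.

HB.instance Definition _ w := Finite.copy (layers w) {k : 'I_w & 'I_k.+1}.

Fact layers_display : Order.disp_t. Proof. exact: Order.Disp tt tt. Qed.

(** * The order of the extremal example *)

Section Layers.
Variable w : nat.
Implicit Types x y : layers w.

Definition layers_lt x y : bool := tag y < tag x.
Definition layers_le x y : bool := (x == y) || layers_lt x y.

Lemma layers_lt_def x y : layers_lt x y = (y != x) && layers_le x y.
Proof.
rewrite /layers_le /layers_lt eq_sym.
by have [->|_] := eqVneq; rewrite ?ltnn.
Qed.

Lemma layers_le_refl : reflexive layers_le.
Proof. by move=> x; rewrite /layers_le eqxx. Qed.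

Lemma layers_le_anti : antisymmetric layers_le.
Proof.
move=> x y /andP[/orP[/eqP//|lt_xy] /orP[/eqP//|lt_yx]].
by have := ltn_trans lt_xy lt_yx; rewrite ltnn.
Qed.

Lemma layers_le_trans : transitive layers_le.
Proof.
move=> y x z /orP[/eqP->//|lt_xy] /orP[/eqP<-|lt_yz]; apply/orP; right=> //.
exact: ltn_trans lt_xy.
Qed.

End Layers.

HB.instance Definition _ w := Order.isPOrder.Build layers_display
  (layers w) (@layers_lt_def w) (@layers_le_refl w) (@layers_le_anti w)
  (@layers_le_trans w).

(** * Antichains of the example and sharpness *)

Section LayersAntichains.
Variable w : nat.
Implicit Types (x y : layers w) (A : {set layers w}).

Definition layer (k : 'I_w) : {set layers w} := [set x | tag x == k].

Lemma le_layers x y : (x <= y)%O = (x == y) || (tag y < tag x).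
Proof. by []. Qed.

Lemma card_layer k : #|layer k| = k.+1.
Proof.
pose in_layer (i : 'I_k.+1) : layers w := Tagged (fun k : 'I_w => 'I_k.+1) i.
have in_layer_inj : injective in_layer.
  by move=> i j /eqP; rewrite eq_Tagged => /eqP.
rewrite -[RHS]card_ord -(card_imset predT in_layer_inj); congr #|pred_of_set _|.
apply/setP => -[j i]; rewrite inE /=; apply/eqP/imsetP => [eq_jk|[i' _ [//]]].
by subst j; exists i.
Qed.

Lemma layer_antichain k : antichain (layer k).
Proof.
apply/antichainP => x y; rewrite !inE le_layers => /eqP-> /eqP->.
by rewrite ltnn orbF => /eqP.
Qed.

(** Elements of different layers are always comparable. *)
Lemma antichain_sub_layer A x :
  antichain A -> x \in A -> A \subset layer (tag x).
Proof.
move=> /antichainP acA xA; apply/subsetP => y yA; rewrite inE -val_eqE /=.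
case: ltngtP => // lt_xy.
  by move: (lt_xy); rewrite (acA x y) ?ltnn // le_layers lt_xy orbT.
by move: (lt_xy); rewrite (acA y x) ?ltnn // le_layers lt_xy orbT.
Qed.

(** A competitor [B] lies in a single layer. The filter inclusion bounds its index above by [k], and
    its [k.+1] elements bound it below by [k]. *)
Lemma layer_maximal (k : 'I_w) : maximal_antichain k.+1 (layer k).
Proof.
rewrite /maximal_antichain layer_antichain card_layer eqxx /=.
apply/forallP => B; apply/implyP => /and3P[acB /eqP cardB leB].
have [x xB] : exists x, x \in B by apply/card_gt0P; rewrite cardB.
have sBx := antichain_sub_layer acB xB.
have : x \in filter_of (layer k).
  by rewrite (subsetP leB) // (subsetP (sub_filter_of B)).
case/filter_ofP=> y; rewrite inE => /eqP eqyk le_yx.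
have lexk : tag x <= k.
  by move: le_yx; rewrite le_layers -eqyk => /orP[/eqP->//|/ltnW].
have := subset_leq_card sBx; rewrite card_layer cardB ltnS => lekx.
have eqxk : tag x = k by apply/val_inj/anti_leq; rewrite lexk lekx.
by rewrite eqEcard -eqxk sBx card_layer cardB eqxk ltnSn.
Qed.

Lemma width_layers : width (layers w) = w.
Proof.
apply/eqP; rewrite eqn_leq; apply/andP; split.
  apply/bigmax_leqP => A acA.
  have [->|[x xA]] := set_0Vmem A; first by rewrite cards0.
  apply: leq_trans (subset_leq_card (antichain_sub_layer acA xA)) _.
  by rewrite card_layer.
(* The bottom layer has index [w - 1] and [w] elements; [w = 0] is trivial. *)
case Dw: {1}w => [//|n]; have ltn : n < w by rewrite Dw.
by rewrite -(card_layer (Ordinal ltn)) antichain_width // layer_antichain.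
Qed.

Lemma card_cover_layers :
  #|cover (maximal_star_antichains (layers w))| = (w * (w + 1)) %/ 2.
Proof.
have -> : cover (maximal_star_antichains (layers w)) = setT.
  apply/setP => x; rewrite inE; apply/bigcupP; exists (layer (tag x)).
    rewrite inE; apply/maximal_star_antichainP.
    by exists (tag x).+1; exact: layer_maximal.
  by rewrite inE.
rewrite cardsT card_tagged sumnE big_map big_enum /=.
(* Dropping the zero term matches the layer sizes [i.+1]. *)
rewrite -triangular_sum big_ord_recl add0n.
by apply: eq_bigr => i _; rewrite card_ord.
Qed.

End LayersAntichains.

Theorem theorem3p7p8 :
  (forall (d : Order.disp_t) (P : finPOrderType d),
     #|cover (maximal_star_antichains P)|
       <= (width P * (width P + 1)) %/ 2)
  /\
  (forall w : nat, 1 <= w ->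
     exists (d : Order.disp_t) (P : finPOrderType d),
       width P = w /\
       #|cover (maximal_star_antichains P)| = (w * (w + 1)) %/ 2).
Proof.
split=> [d P|w _]; first exact: card_cover_maximal_star.
exists layers_display, (layers w).
by split; [exact: width_layers | exact: card_cover_layers].
Qed.
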